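(* Assume that $h=h(x,t)$ and $\zeta=\zeta(x,t)$ satisfy, on $\mathbf{T}=\mathbf{R}/(\omega\mathbf{Z})$, $$\tau h_t=\sigma_1 h_{xx}-f,\qquad f=\sum_{k=1}^K c_k\,\delta(x-a_k)-A,$$ and $$\zeta_t=\sigma_2\zeta_{xx}-\alpha(\zeta-h),$$ respectively. Let $\eta=\zeta-h$. (i) If $\tau>0$ and $\sigma_2=\sigma_1/\tau$, then $$\eta_t=\sigma_2\eta_{xx}-\alpha\eta+\frac{f}{\tau}.$$ (ii) If $\tau=0$ in the equation for $h$, then $$\eta_t=\sigma_2\eta_{xx}-\alpha\eta+\frac{\sigma_2}{\sigma_1}f.$$
   Context: Here $\omega>0$ is a fixed period, $\sigma_1>0$, $\sigma_2>0$ and $\alpha\ge 0$ are constants, $\tau$ is a relaxation parameter (positive, or zero in the case (ii), where the equation for $h$ reads $\sigma_1h_{xx}=f$), $K\ge 1$, $0\le a_1<a_2<\cdots<a_K<\omega$ are fixed points, $c_1,\dots,c_K$ and $A$ are given real constants, and $\delta$ is Dirac's delta function on $\mathbf{T}$. All functions are $\omega$-periodic in $x$.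
   Formalization: In (ii) it is also assumed that the spatial mean of h over a period is constant in t (for a.e. t); without it (ii) fails, e.g. c_k=A=α=0, h=t, ζ=0, since σ₁h_xx=f leaves a free additive function of t. *)

(* Defs.v *)
From HB Require Import structures.
From mathcomp Require Import all_boot all_order all_algebra.
From mathcomp Require Import all_classical all_reals all_analysis.
Set Implicit Arguments.
Unset Strict Implicit.
Unset Printing Implicit Defensive.
Import Order.TTheory GRing.Theory Num.Theory.
Import numFieldNormedType.Exports.
Local Open Scope classical_set_scope.
Local Open Scope ring_scope.

(* Points of the (x, t)-plane are pairs (x, t) : R * R. Functions on the
   cylinder T x ]t0, t1[, T = R / omega Z, are functions on R * R that are
   omega-periodic in x; the endpoints t0, t1 of the time interval may be
   infinite. *)

Section Defs.
Variables (R : realType) (omega : R) (t0 t1 : \bar R).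

Definition time_interval : set R := [set t | (t0 < t%:E < t1)%E].

Definition cylinder : set (R * R) :=
  `[0, omega] `*` time_interval.

Definition plane_measure :
    {measure set (measurableTypeR R * measurableTypeR R) -> \bar R} :=
  (@lebesgue_measure R \x @lebesgue_measure R)%E.

Definition pdx (phi : R * R -> R) : R * R -> R := 'D_(1, 0) phi.
Definition pdt (phi : R * R -> R) : R * R -> R := 'D_(0, 1) phi.

Fixpoint class_C (n : nat) (phi : R * R -> R) : Prop :=
  if n is m.+1 then
    [/\ continuous phi,
        forall z, derivable phi z (1, 0),
        forall z, derivable phi z (0, 1),
        class_C m (pdx phi) &
        class_C m (pdt phi)]
  else continuous phi.

Definition smooth (phi : R * R -> R) : Prop := forall n, class_C n phi.

Definition x_periodic (u : R * R -> R) : Prop :=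
  forall x t, time_interval t -> u (x + omega, t) = u (x, t).

Definition test_function (phi : R * R -> R) : Prop :=
  [/\ smooth phi,
      forall x t, phi (x + omega, t) = phi (x, t) &
      exists s0 s1, [/\ time_interval s0, time_interval s1 &
        forall x t, ~ (s0 <= t <= s1) -> phi (x, t) = 0]].

(* A distribution on the cylinder is represented by its action on test
   functions (its value elsewhere is irrelevant, see eq_distr); sums and
   scalar multiples are those of the pointwise module structure. *)
Definition distr : Type := (R * R -> R) -> R.
HB.instance Definition _ := GRing.Lmodule.on distr.

Definition eq_distr (u v : distr) : Prop :=
  forall phi, test_function phi -> u phi = v phi.

Definition dt (u : distr) : distr := fun phi => - u (pdt phi).
Definition dxx (u : distr) : distr := fun phi => u (pdx (pdx phi)).

Definition regular (u : R * R -> R) : distr :=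
  fun phi => \int[plane_measure]_(z in cylinder) (u z * phi z).

(* delta (x - a) on T, constant in time. Test functions are omega-periodic
   in x, so this is the periodic Dirac delta. *)
Definition delta (a : R) : distr :=
  fun phi => \int[lebesgue_measure]_(t in time_interval) phi (a, t).

Definition source (K : nat) (c a : 'I_K -> R) (A : R) : distr :=
  \sum_k c k *: delta (a k) - regular (cst A).

Definition loc_integrable (u : R * R -> R) : Prop :=
  forall s0 s1, time_interval s0 -> time_interval s1 ->
    plane_measure.-integrable (`[0, omega] `*` `[s0, s1]) (EFin \o u).

Definition cylinder_function (u : R * R -> R) : Prop :=
  x_periodic u /\ loc_integrable u.

(* The equation sigma1 h_xx = f determines h only up to an arbitrary additive
   function of t. For tau > 0 the spatial mean of h is conserved as soon as
   f has mean zero (which sigma1 h_xx = f forces); this predicate is the same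
   normalization for tau = 0. It holds if h does not depend on t, and if h
   has zero spatial mean. *)
Definition mean_conserved (u : R * R -> R) : Prop :=
  exists m : R, {ae @lebesgue_measure R, forall t, time_interval t ->
    \int[lebesgue_measure]_(x in `[0, omega]) u (x, t) = m}.

End Defs.

(* Main.v *)
Require Import Defs.
From HB Require Import structures.
From mathcomp Require Import all_boot all_order all_algebra.
From mathcomp Require Import all_classical all_reals all_analysis.
From mathcomp Require Import measurable_realfun ring lra.
Set Implicit Arguments.
Unset Strict Implicit.
Unset Printing Implicit Defensive.
Import Order.TTheory GRing.Theory Num.Theory.
Import numFieldNormedType.Exports.
Local Open Scope classical_set_scope.
Local Open Scope ring_scope.

(** Part (i) is linear algebra: eta = zeta - h, the pairing of a locally
    integrable function with a test function is linear in the function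
    ([regularB]), and subtracting the equation for h divided by tau from the
    equation for zeta gives the result because sigma2 = sigma1 / tau makes the
    two diffusion coefficients equal.

    For part (ii) the same subtraction, with h_xx = f / sigma1, leaves exactly
    the term - h_t, so everything rests on showing that h_t = 0
    ([dt_eq0_of_dxx_eq_source]). Formally: f does not depend on t, so
    (h_t)_xx = 0 on the circle, hence h_t depends on t only, and the
    conservation of the spatial mean makes it vanish. For distributions this is
    done by duality. Given a test function phi, split phi_t into its spatial
    mean and its fluctuation:

    - the fluctuation is X_xx for a test function X obtained by integrating
      twice in x, removing the spatial mean before each integration so that the
      primitive stays periodic ([inv_dxx], [pdxx_inv_dxx]). This construction
      commutes with the time derivative ([pdt_inv_dxx]), so X is itself a time
      derivative, and sigma1 < h, X_xx > = < f, X > = 0, since a source which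
      is constant in time annihilates time derivatives ([source_pdt]);
    - against the mean, which depends on t only, Fubini's theorem replaces h by
      its constant spatial integral ([integral_rect_separated]), and what
      remains is the integral of the time derivative of a compactly supported
      function ([regular_mean_pdt]).

    The analytic work is the smoothness of the primitive in x. It is written
    as x * \int_0^1 phi (x s, t) ds, an integral over a fixed segment, so that
    continuity and both partial derivatives come from theorems on parametric
    integrals ([continuous_integral01], [is_derive_integral01]), whatever the
    sign of x. *)

(** * Functions of class C^n on the plane *)

Lemma continuous_comp_pair {T U V W : topologicalType} (g : U * V -> W)
    (u : T -> U) (v : T -> V) :
  continuous u -> continuous v -> continuous g ->
  continuous (fun z => g (u z, v z)).
Proof.
move=> cu cv cg z.
exact: (cvg_comp _ _ (cvg_pair (cu z) (cv z)) (cg (u z, v z))).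
Qed.

Section partial_derivatives.
Context {R : realType}.
Implicit Types (f g : R * R -> R).

(** Both sides are difference quotients; this and its time analogue carry the
    one-variable calculus of [is_derive] over to [pdx] and [pdt]. *)
Lemma pdx_lineE f (x t : R) :
  (fun k : R => k^-1 *: ((f \o shift (x, t)) (k *: ((1, 0) : R * R))
                         - f (x, t)))
  = (fun k : R => k^-1 *: (((fun y => f (y, t)) \o shift x) (k *: (1 : R))
                           - f (x, t))).
Proof.
apply/funext => k; congr (_ *: (f _ - _)).
by rewrite /shift/=; congr pair; rewrite /= ?scaler0 ?add0r.
Qed.

Lemma pdt_lineE f (x t : R) :
  (fun k : R => k^-1 *: ((f \o shift (x, t)) (k *: ((0, 1) : R * R))
                         - f (x, t)))
  = (fun k : R => k^-1 *: (((fun s => f (x, s)) \o shift t) (k *: (1 : R))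
                           - f (x, t))).
Proof.
apply/funext => k; congr (_ *: (f _ - _)).
by rewrite /shift/=; congr pair; rewrite /= ?scaler0 ?add0r.
Qed.

Lemma is_derive_pdxP f (x t d : R) :
  is_derive x 1 (fun y => f (y, t)) d <->
  derivable f (x, t) (1, 0) /\ pdx f (x, t) = d.
Proof.
split=> [[df dfE]|[df dfE]].
  split; first by rewrite /derivable pdx_lineE.
  by rewrite /pdx /derive pdx_lineE.
apply: DeriveDef; first by move: df; rewrite /derivable pdx_lineE.
by move: dfE; rewrite /pdx /derive pdx_lineE.
Qed.

Lemma is_derive_pdtP f (x t d : R) :
  is_derive t 1 (fun s => f (x, s)) d <->
  derivable f (x, t) (0, 1) /\ pdt f (x, t) = d.
Proof.
split=> [[df dfE]|[df dfE]].
  split; first by rewrite /derivable pdt_lineE.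
  by rewrite /pdt /derive pdt_lineE.
apply: DeriveDef; first by move: df; rewrite /derivable pdt_lineE.
by move: dfE; rewrite /pdt /derive pdt_lineE.
Qed.

Lemma class_CS n f : class_C n.+1 f -> class_C n f.
Proof.
elim: n f => [f []//|n IH f [cf dx dt cx ct]].
by exact: And5 cf dx dt (IH _ cx) (IH _ ct).
Qed.

Lemma class_C_continuous n f : class_C n f -> continuous f.
Proof. by case: n => [//|n] []. Qed.

Lemma class_C_is_derive_pdx n f (x t : R) : class_C n.+1 f ->
  is_derive x 1 (fun y => f (y, t)) (pdx f (x, t)).
Proof. by case=> _ dx _ _ _; apply/is_derive_pdxP. Qed.

Lemma class_C_is_derive_pdt n f (x t : R) : class_C n.+1 f ->
  is_derive t 1 (fun s => f (x, s)) (pdt f (x, t)).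
Proof. by case=> _ _ dt _ _; apply/is_derive_pdtP. Qed.

(** Supplying the partial derivatives as functions fx and ft lets an induction
    on n apply its hypothesis to explicit expressions. *)
Lemma class_CS_intro n f (fx ft : R * R -> R) : continuous f ->
  (forall x t : R, is_derive x 1 (fun y => f (y, t)) (fx (x, t))) ->
  (forall x t : R, is_derive t 1 (fun s => f (x, s)) (ft (x, t))) ->
  class_C n fx -> class_C n ft -> class_C n.+1 f.
Proof.
move=> cf dx dt cx ct; split.
- exact: cf.
- by move=> [x t]; have /is_derive_pdxP[] := dx x t.
- by move=> [x t]; have /is_derive_pdtP[] := dt x t.
- rewrite (_ : pdx f = fx); first exact: cx.
  by apply/funext => -[x t]; have /is_derive_pdxP[] := dx x t.
- rewrite (_ : pdt f = ft); first exact: ct.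
  by apply/funext => -[x t]; have /is_derive_pdtP[] := dt x t.
Qed.

Lemma class_C0 n : class_C n (fun=> 0 : R).
Proof.
elim: n => [|n IH]; first exact: cst_continuous.
apply: (class_CS_intro _ _ _ IH IH); first exact: cst_continuous.
- by move=> x t; exact: is_derive_cst.
- by move=> x t; exact: is_derive_cst.
Qed.

Lemma class_CB n f g :
  class_C n f -> class_C n g -> class_C n (fun z => f z - g z).
Proof.
elim: n f g => [|n IH] f g.
  by move=> cf cg z; apply: cvgB; [exact: cf|exact: cg].
move=> Cf Cg.
have [cf _ _ fx ft] := Cf; have [cg _ _ gx gt] := Cg.
apply: (class_CS_intro _ _ _ (IH _ _ fx gx) (IH _ _ ft gt)).
- by move=> z; apply: cvgB; [exact: cf|exact: cg].
- move=> x t; have df := class_C_is_derive_pdx x t Cf.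
  by have dg := class_C_is_derive_pdx x t Cg; exact: is_deriveB df dg.
- move=> x t; have df := class_C_is_derive_pdt x t Cf.
  by have dg := class_C_is_derive_pdt x t Cg; exact: is_deriveB df dg.
Qed.

Lemma class_CZ n (k : R) f : class_C n f -> class_C n (fun z => k * f z).
Proof.
elim: n f => [|n IH] f.
  by move=> cf z; apply: cvgMr; exact: cf.
move=> Cf; have [cf _ _ fx ft] := Cf.
apply: (class_CS_intro _ _ _ (IH _ fx) (IH _ ft)).
- by move=> z; apply: cvgMr; exact: cf.
- move=> x t; have df := class_C_is_derive_pdx x t Cf.
  exact: is_deriveZ df.
- move=> x t; have df := class_C_is_derive_pdt x t Cf.
  exact: is_deriveZ df.
Qed.

Lemma class_C_time_trace n (b : R) f :
  class_C n f -> class_C n (fun z => f (b, z.2)).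
Proof.
have cpair g : continuous g -> continuous (fun z : R * R => g (b, z.2)).
  move=> cg; apply: continuous_comp_pair cg.
    exact: cst_continuous.
  by move=> z; exact: cvg_snd.
elim: n f => [|n IH] f; first exact: cpair.
move=> Cf; have [cf _ _ fx ft] := Cf.
apply: (class_CS_intro _ _ _ (class_C0 n) (IH _ ft)).
- exact: cpair.
- by move=> x t; exact: (is_derive_cst (f (b, t)) x 1).
- by move=> x t; exact: (class_C_is_derive_pdt b t Cf).
Qed.

Lemma smooth_pdx f : smooth f -> smooth (pdx f).
Proof. by move=> sf n; case: (sf n.+1). Qed.

Lemma smooth_pdt f : smooth f -> smooth (pdt f).
Proof. by move=> sf n; case: (sf n.+1). Qed.

End partial_derivatives.

(** * Integrals over [0, 1] depending on a parameter *)

Lemma continuous_section2 {T U V : topologicalType} (F : T * U -> V) (z : T) :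
  continuous F -> continuous (fun s => F (z, s)).
Proof.
move=> cF; apply: continuous_comp_pair cF; first exact: cst_continuous.
by move=> s; exact: cvg_id.
Qed.

Section parametric_integrals.
Context {R : realType}.
Notation mu := (@lebesgue_measure R).

Lemma continuous_integrable_itvcc (f : R -> R) (a b : R) : continuous f ->
  mu.-integrable `[a, b] (EFin \o f).
Proof.
move=> cf; apply: continuous_compact_integrable; first exact: segment_compact.
exact: continuous_subspaceT.
Qed.

Lemma Rintegral_FTC2 (F f : R -> R) (a b : R) : a < b -> continuous f ->
  (forall s : R, is_derive s 1 F (f s)) ->
  \int[mu]_(s in `[a, b]) f s = F b - F a.
Proof.
move=> ab cf dF; have cF : continuous F.
  move=> s; have [dFs _] := dF s.
  exact/differentiable_continuous/derivable1_diffP.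
rewrite /Rintegral (@continuous_FTC2 _ f F)//.
- exact: continuous_subspaceT.
- split.
  + by move=> s _; have [] := dF s.
  + exact/cvg_at_right_filter/cF.
  + exact/cvg_at_left_filter/cF.
- by move=> s _; rewrite derive1E; have [_ ->] := dF s.
Qed.

(** On the compact segment the continuity of F in its first argument is
    uniform, which bounds the difference of the integrals. *)
Lemma continuous_integral01 (T : topologicalType) (F : T * R -> R) :
  continuous F -> continuous (fun z => \int[mu]_(s in `[0, 1]) F (z, s)).
Proof.
move=> cF z; apply/cvgrPdist_le => e e0 /=.
have cFz z' : continuous (fun s => F (z', s)).
  exact: continuous_section2.
have := @segment_compact R 0 1.
move/compact_near_coveringP/(_ T (nbhs z)
  (fun z' s => `|F (z, s) - F (z', s)| <= e)) => near_unif.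
have : \forall z' \near z, `[0, 1] `<=` (fun s => `|F (z, s) - F (z', s)| <= e).
  apply: near_unif => s _.
  have e20 : 0 < e / 2 by rewrite divr_gt0.
  have F1 : \forall s' \near s & z' \near z, `|F (z, s) - F (z', s')| < e / 2.
    have /cvgrPdist_lt/(_ _ e20) := cF (z, s).
    case=> -[U V]/= [Uz Vs] UV; exists (V, U) => //=.
    by move=> [s' z'] /= [Vs' Uz']; apply: (UV (z', s')).
  have /cvgrPdist_lt/(_ _ e20) F2 := cFz z s.
  have {}F2 : \forall s' \near s & z' \near z, `|F (z, s) - F (z, s')| < e / 2.
    exact: (@cvg_fst _ _ (nbhs s) (nbhs z) _ _ F2).
  apply: filterS2 F1 F2 => -[s' z'] /= {}F1 {}F2.
  rewrite -(subrK (F (z, s)) (F (z, s'))) -addrA (le_trans (ler_normD _ _))//.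
  by rewrite (splitr e) lerD// ltW// distrC.
apply: filterS => z' Hz'.
rewrite -RintegralB//; [|exact: continuous_integrable_itvcc..].
have iD : mu.-integrable `[0, 1] (EFin \o (fun s => F (z, s) - F (z', s))).
  apply: continuous_integrable_itvcc => s.
  by apply: cvgB; exact: cFz.
apply: (le_trans (le_normr_Rintegral _ iD)) => //.
have -> : e = \int[mu]_(s in `[0, 1]) (cst e) s.
  have mu01 : mu `[0, 1]%classic = 1%E.
    by rewrite lebesgue_measure_itv/= lte_fin ltr01 -EFinB subr0.
  by rewrite (@Rintegral_cst _ _ _ mu `[0, 1]%classic _ e)//
    [X in fine X]mu01 mulr1.
apply: le_Rintegral => //.
- exact: (integrable_norm iD).
- by apply: continuous_integrable_itvcc; exact: cst_continuous.
Qed.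

(** Differentiation under the integral sign; the dominating function is a
    constant, namely a bound of dG on [y - 1, y + 1] x [0, 1]. *)
Lemma is_derive_integral01 (G dG : R * R -> R) (y : R) :
  continuous G -> continuous dG ->
  (forall y s : R, is_derive y 1 (fun y' => G (y', s)) (dG (y, s))) ->
  is_derive y 1 (fun y' => \int[mu]_(s in `[0, 1]) G (y', s))
    (\int[mu]_(s in `[0, 1]) dG (y, s)).
Proof.
move=> cG cdG dGE.
have [M MdG] : exists M : R, forall y' s, `]y - 1, y + 1[%classic y' ->
    `[0, 1]%classic s ->
    `|dG (y', s)| <= M.
  have : compact (dG @` (`[y - 1, y + 1] `*` `[0, 1])).
    apply: continuous_compact; first exact: continuous_subspaceT.
    by apply: compact_setX; exact: segment_compact.
  move=> /compact_bounded[M [_ HM]]; exists (M + 1) => y' s yI sI.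
  apply: (HM (M + 1)); first by rewrite ltrDl.
  by exists (y', s) => //; split => //; exact: subset_itv_oo_cc yI.
have Iy : `]y - 1, y + 1[%classic y.
  by rewrite /= in_itv/= ltrBlDr ltrDl ltr01.
have iG y' : mu.-integrable `[0, 1] (EFin \o (fun s => G (y', s))).
  apply: continuous_integrable_itvcc.
  exact: continuous_section2.
have d1E y' s : partial1of2 (fun y s => G (y, s)) y' s = dG (y', s).
  by rewrite partial1of2E; have [_ ->] := dGE y' s.
have dG1 y' s : `]y - 1, y + 1[%classic y' -> `[0, 1]%classic s ->
  derivable (fun y => G (y, s)) y' 1 by have [] := dGE y' s.
have M0 (s : R) : 0 <= Num.max M 0 by rewrite le_max lexx orbT.
have iM : mu.-integrable `[0, 1] (EFin \o cst (Num.max M 0)).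
  by apply: continuous_integrable_itvcc; exact: cst_continuous.
have MdG' y' s : `]y - 1, y + 1[%classic y' -> `[0, 1]%classic s ->
    `|partial1of2 (fun y s => G (y, s)) y' s| <= Num.max M 0.
  by move=> yI sI; rewrite d1E le_max MdG.
apply: DeriveDef.
  exact: (@derivable_under_integral _ _ _ mu (fun y s => G (y, s))
    _ _ _ _ _ Iy _ dG1 _ M0 iM MdG').
rewrite -derive1E.
rewrite (@differentiation_under_integral _ _ _ mu (fun y s => G (y, s))
  _ _ _ _ _ Iy _ dG1 _ M0 iM MdG')//.
by apply: eq_Rintegral => s _; exact: d1E.
Qed.

End parametric_integrals.

(** * Primitives in the space variable *)

Section x_primitive.
Context {R : realType}.
Implicit Types (f g : R * R -> R) (x t : R).
Notation mu := (@lebesgue_measure R).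

(** The primitive of f in x vanishing at x = 0, after the substitution that
    makes the domain of integration independent of x and valid for x < 0. *)
Definition prim f : R * R -> R :=
  fun z => z.1 * \int[mu]_(s in `[0, 1]) f (z.1 * s, z.2).

Lemma prim0 f t : prim f (0, t) = 0.
Proof. by rewrite /prim mul0r. Qed.

Lemma continuous_scaled f : continuous f ->
  continuous (fun p : (R * R) * R => f (p.1.1 * p.2, p.1.2)).
Proof.
have c11 : continuous (fun p : (R * R) * R => p.1.1).
  move=> p; apply: (@cvg_comp _ _ _ fst fst); first exact: cvg_fst.
  exact: cvg_fst.
have c12 : continuous (fun p : (R * R) * R => p.1.2).
  move=> p; apply: (@cvg_comp _ _ _ fst snd); first exact: cvg_fst.
  exact: cvg_snd.
have c2 : continuous (fun p : (R * R) * R => p.2) by move=> p; exact: cvg_snd.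
apply: continuous_comp_pair c12 => p.
by apply: cvgM; [exact: c11|exact: c2].
Qed.

Lemma continuous_prim f : continuous f -> continuous (prim f).
Proof.
move=> cf z; apply: cvgM; first exact: cvg_fst.
exact: (continuous_integral01 (continuous_scaled cf)).
Qed.

(** The product rule gives \int f (x s) ds + x \int s f_x (x s) ds, whose
    integrand is the derivative in s of s * f (x s, t); the fundamental theorem
    of calculus on [0, 1] then yields f (x, t). *)
Lemma is_derive_prim_x f x t : class_C 1 f ->
  is_derive x 1 (fun y => prim f (y, t)) (f (x, t)).
Proof.
move=> Cf; have cf := class_C_continuous Cf; have [_ _ _ cfx _] := Cf.
have csc g : continuous g -> continuous (fun p : R * R => g (p.1 * p.2, t)).
  move=> cg; apply: (continuous_comp_pair _ _ cg); last exact: cst_continuous.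
  by move=> p; apply: cvgM; [exact: cvg_fst|exact: cvg_snd].
have dsc (y s : R) :
    is_derive y 1 (fun y' => f (y' * s, t)) (s * pdx f (y * s, t)).
  have df := class_C_is_derive_pdx (y * s) t Cf.
  have ds : is_derive y 1 (fun y' => y' * s) s.
    have := is_deriveM (is_derive_id y 1) (is_derive_cst s y 1).
    by rewrite scaler0 add0r /GRing.scale/= mulr1.
  rewrite mulrC.
  exact: (@is_derive1_comp _ (fun y => f (y, t)) ( *%R^~ s) _ _ _ df ds).
have dsc' (s : R) : is_derive s 1 (fun s => s * f (x * s, t))
    (f (x * s, t) + x * (s * pdx f (x * s, t))).
  have df := class_C_is_derive_pdx (x * s) t Cf.
  have ds : is_derive s 1 (fun y' => x * y') x.
    have := is_deriveM (is_derive_cst x s 1) (is_derive_id s 1).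
    by rewrite scaler0 addr0 /GRing.scale/= mulr1.
  have := is_deriveM (is_derive_id s 1)
    (@is_derive1_comp _ (fun y => f (y, t)) ( *%R x) _ _ _ df ds).
  by rewrite /GRing.scale/= mulr1 addrC (mulrC _ x) mulrCA.
pose G (p : R * R) := f (p.1 * p.2, t).
pose dG (p : R * R) := p.2 * pdx f (p.1 * p.2, t).
have cdG : continuous dG.
  by move=> p; apply: cvgM; [exact: cvg_snd|exact: (csc _ cfx)].
have cG : continuous G by exact: csc.
have dJ := is_derive_integral01 x cG cdG dsc.
have := is_deriveM (is_derive_id x 1) dJ.
rewrite /GRing.scale/= mulr1.
suff -> : x * \int[mu]_(s in `[0, 1]) dG (x, s)
    + \int[mu]_(s in `[0, 1]) G (x, s) = f (x, t) by [].
have cGx : continuous (fun s => G (x, s)) by exact: continuous_section2.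
have cdGx : continuous (fun s => dG (x, s)) by exact: continuous_section2.
have cxdGx : continuous (fun s => x * dG (x, s)).
  by move=> s; apply: cvgMr; exact: cdGx.
rewrite -RintegralZl//; last exact: continuous_integrable_itvcc.
rewrite addrC -RintegralD//; [|exact: continuous_integrable_itvcc..].
rewrite (Rintegral_FTC2 _ _ dsc')//; last first.
  by move=> s; apply: cvgD; [exact: cGx|exact: cxdGx].
by rewrite mul1r mulr1 mul0r subr0.
Qed.

Lemma is_derive_prim_t f x t : class_C 1 f ->
  is_derive t 1 (fun s => prim f (x, s)) (prim (pdt f) (x, t)).
Proof.
move=> Cf; have cf := class_C_continuous Cf; have [_ _ _ _ cft] := Cf.
have csc g : continuous g -> continuous (fun p : R * R => g (x * p.2, p.1)).
  move=> cg; apply: (continuous_comp_pair _ _ cg); last first.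
    by move=> p; exact: cvg_fst.
  by move=> p; apply: cvgMr; exact: cvg_snd.
apply: is_deriveZ; apply: (is_derive_integral01 t (csc _ cf) (csc _ cft)).
by move=> {}t s; exact: (class_C_is_derive_pdt (x * s) t Cf).
Qed.

(** Induction on n, since the partial derivatives of [prim f] are f and
    [prim (pdt f)]. *)
Lemma class_C_prim n f : class_C n f -> class_C n (prim f).
Proof.
elim: n f => [|n IH] f; first exact: continuous_prim.
move=> Cf.
have C1 : class_C 1 f.
  elim: n {IH} Cf => [//|n IHn Cf]; apply: IHn; exact: class_CS.
have [cf _ _ fx ft] := Cf.
apply: (class_CS_intro _ _ _ (class_CS Cf) (IH _ ft)).
- exact: continuous_prim.
- by move=> x t; exact: is_derive_prim_x.
- by move=> x t; exact: is_derive_prim_t.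
Qed.

(** Identities between primitives are all obtained from this uniqueness, rather
    than by changes of variables in integrals. *)
Lemma prim_unique f (F : R -> R) x t : class_C 1 f ->
  (forall y : R, is_derive y 1 F (f (y, t))) -> prim f (x, t) = F x - F 0.
Proof.
move=> Cf dF.
have dD (y : R) : is_derive y 1 (fun y => prim f (y, t) - F y) 0.
  have := is_deriveB (is_derive_prim_x y t Cf) (dF y).
  by rewrite subrr.
have := is_derive_0_is_cst x 0 dD.
by rewrite prim0 => /eqP; rewrite sub0r subr_eq addrC => /eqP.
Qed.

End x_primitive.

(** * Inverting the second space derivative on test functions *)

Section test_functions.
Context {R : realType} (omega : R) (t0 t1 : \bar R).
Hypothesis omega_gt0 : 0 < omega.
Implicit Types (f g phi : R * R -> R) (x t : R).

Let period f : Prop := forall x t, f (x + omega, t) = f (x, t).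

Lemma smooth_pdx_prim f : smooth f -> pdx (prim f) = f.
Proof.
move=> sf; apply/funext => -[x t].
by have /is_derive_pdxP[] := is_derive_prim_x x t (sf 1).
Qed.

Lemma smooth_pdt_prim f : smooth f -> pdt (prim f) = prim (pdt f).
Proof.
move=> sf; apply/funext => -[x t].
by have /is_derive_pdtP[] := is_derive_prim_t x t (sf 1).
Qed.

Lemma smooth_prim f : smooth f -> smooth (prim f).
Proof. by move=> sf n; exact: class_C_prim. Qed.

Definition mean f : R * R -> R := fun z => omega^-1 * prim f (omega, z.2).

Definition fluct f : R * R -> R := fun z => f z - mean f z.

Lemma smooth_mean f : smooth f -> smooth (mean f).
Proof.
move=> sf n; apply: class_CZ; apply: class_C_time_trace; exact: class_C_prim.
Qed.

Lemma smooth_fluct f : smooth f -> smooth (fluct f).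
Proof. by move=> sf n; apply: class_CB; [exact: sf|exact: smooth_mean]. Qed.

Lemma is_derive_mean_t f (x t : R) : smooth f ->
  is_derive t 1 (fun s => mean f (x, s)) (mean (pdt f) (x, t)).
Proof.
move=> sf; have d := is_derive_prim_t omega t (sf 1).
exact: (@is_deriveZ _ _ _ (fun s => prim f (omega, s)) omega^-1 t 1 _ d).
Qed.

Lemma smooth_pdt_fluct f : smooth f -> pdt (fluct f) = fluct (pdt f).
Proof.
move=> sf; apply/funext => -[x t].
have df := class_C_is_derive_pdt x t (sf 1).
have dm := is_derive_mean_t x t sf.
exact: ((is_derive_pdtP (fluct f) x t _).1 (is_deriveB df dm)).2.
Qed.

Lemma smooth_pdx_fluct f : smooth f -> pdx (fluct f) = pdx f.
Proof.
move=> sf; apply/funext => -[x t].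
have df := class_C_is_derive_pdx x t (sf 1).
have dm := is_derive_cst (mean f (0, t)) x 1.
rewrite -[RHS]subr0.
exact: ((is_derive_pdxP (fluct f) x t _).1 (is_deriveB df dm)).2.
Qed.

Lemma period_fluct f : period f -> period (fluct f).
Proof. by move=> pf x t; rewrite /fluct pf. Qed.

Lemma prim_fluct_period f t : smooth f -> prim (fluct f) (omega, t) = 0.
Proof.
move=> sf.
pose F y := prim f (y, t) - mean f (0, t) * y.
have dF (y : R) : is_derive y 1 F (fluct f (y, t)).
  have d1 := is_derive_prim_x y t (sf 1).
  have d2 := @is_deriveZ _ _ _ _ (mean f (0, t)) _ _ _ (is_derive_id y 1).
  have := is_deriveB d1 d2.
  by rewrite /GRing.scale/= mulr1.
rewrite (prim_unique omega (smooth_fluct sf 1) dF) /F prim0 mulr0 !subr0.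
by rewrite /mean/= mulrAC mulVf ?gt_eqF// mul1r subrr.
Qed.

(** The shifted primitive has the same x-derivative, and the constant by which
    they differ is the integral over a period. *)
Lemma period_prim f : smooth f -> period f ->
  (forall t, prim f (omega, t) = 0) -> period (prim f).
Proof.
move=> sf pf f0 x t; symmetry.
have dF (y : R) : is_derive y 1 (fun y => prim f (y + omega, t)) (f (y, t)).
  have d := is_derive_prim_x (y + omega) t (sf 1).
  have := @is_derive1_comp _ (fun y => prim f (y, t)) (shift omega) _ _ _ d
    (is_derive_shift y 1 omega).
  by rewrite mulr1 pf.
by rewrite (prim_unique x (sf 1) dF) add0r f0 subr0.
Qed.

(** The second primitive in x of the fluctuation of f. The inner fluctuation
    makes the first primitive periodic, the outer one the second. *)
Definition inv_dxx f : R * R -> R := prim (fluct (prim (fluct f))).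

Lemma smooth_inv_dxx f : smooth f -> smooth (inv_dxx f).
Proof.
by move=> sf; apply/smooth_prim/smooth_fluct/smooth_prim; exact: smooth_fluct.
Qed.

Lemma period_inv_dxx f : smooth f -> period f -> period (inv_dxx f).
Proof.
move=> sf pf.
have sg : smooth (prim (fluct f)) by exact/smooth_prim/smooth_fluct.
apply: period_prim.
- exact: smooth_fluct.
- apply: period_fluct; apply: period_prim.
  + exact: smooth_fluct.
  + exact: period_fluct.
  + by move=> t; exact: prim_fluct_period.
- by move=> t; exact: prim_fluct_period.
Qed.

Lemma pdxx_inv_dxx f : smooth f -> pdx (pdx (inv_dxx f)) = fluct f.
Proof.
move=> sf; have sg : smooth (prim (fluct f)) by exact/smooth_prim/smooth_fluct.
rewrite smooth_pdx_prim; last exact: smooth_fluct.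
by rewrite smooth_pdx_fluct// smooth_pdx_prim//; exact: smooth_fluct.
Qed.

Lemma pdt_inv_dxx f : smooth f -> pdt (inv_dxx f) = inv_dxx (pdt f).
Proof.
move=> sf; have sg : smooth (prim (fluct f)) by exact/smooth_prim/smooth_fluct.
rewrite smooth_pdt_prim; last exact: smooth_fluct.
rewrite smooth_pdt_fluct; last exact: sg.
rewrite smooth_pdt_prim; last exact: smooth_fluct.
by rewrite smooth_pdt_fluct; last exact: sf.
Qed.

Lemma prim_eq0 f t : (forall x, f (x, t) = 0) -> forall x, prim f (x, t) = 0.
Proof.
move=> f0 x; rewrite /prim/=; under eq_Rintegral do rewrite f0.
by rewrite Rintegral_cst// mul0r mulr0.
Qed.

Lemma mean_eq0 f t : (forall x, f (x, t) = 0) -> forall x, mean f (x, t) = 0.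
Proof. by move=> f0 x; rewrite /mean/= prim_eq0// mulr0. Qed.

Lemma inv_dxx_eq0 f t :
  (forall x, f (x, t) = 0) -> forall x, inv_dxx f (x, t) = 0.
Proof.
have fl0 g : (forall x, g (x, t) = 0) -> forall x, fluct g (x, t) = 0.
  by move=> g0 x; rewrite /fluct g0 mean_eq0// subr0.
by move=> f0; apply: prim_eq0; apply: (fl0); apply: prim_eq0; exact: fl0.
Qed.

Lemma test_function_inv_dxx phi :
  test_function omega t0 t1 phi -> test_function omega t0 t1 (inv_dxx phi).
Proof.
move=> [sphi pphi [s0 [s1 [Is0 Is1 phi0]]]]; split.
- exact: smooth_inv_dxx.
- exact: period_inv_dxx.
- exists s0, s1; split=> // x t st.
  by apply: inv_dxx_eq0 => y; exact: phi0.
Qed.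

(** The complement of [s0, s1] is open, so f vanishes near each of its
    points. *)
Lemma pdt_eq0 f (s0 s1 : R) :
  (forall x t, ~ (s0 <= t <= s1) -> f (x, t) = 0) ->
  forall x t, ~ (s0 <= t <= s1) -> pdt f (x, t) = 0.
Proof.
move=> f0 x t /negP; rewrite negb_and -!ltNge => tout.
apply: ((is_derive_pdtP f x t 0).1 _).2.
apply: near_eq_is_derive (is_derive_cst 0 t 1).
have : \forall s \near t, s < s0 \/ s1 < s.
  case/orP: tout => ts.
    by near=> s; left; near: s; exact: lt_nbhsl.
  by near=> s; right; near: s; exact: lt_nbhsr.
apply: filterS => s sout; symmetry; apply: f0 => /andP[].
by case: sout => /lt_geF ->.
Unshelve. all: by end_near. Qed.

Lemma test_function_pdt phi :
  test_function omega t0 t1 phi -> test_function omega t0 t1 (pdt phi).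
Proof.
move=> [sphi pphi [s0 [s1 [Is0 Is1 phi0]]]]; split.
- exact: smooth_pdt.
- move=> x t; have d := class_C_is_derive_pdt x t (sphi 1).
  apply: ((is_derive_pdtP phi (x + omega) t _).1 _).2.
  by under eq_fun do rewrite pphi.
- by exists s0, s1; split=> //; exact: pdt_eq0.
Qed.

Lemma test_function_pdx phi :
  test_function omega t0 t1 phi -> test_function omega t0 t1 (pdx phi).
Proof.
move=> [sphi pphi [s0 [s1 [Is0 Is1 phi0]]]]; split.
- exact: smooth_pdx.
- move=> x t.
  have d := class_C_is_derive_pdx (x + omega) t (sphi 1).
  have := @is_derive1_comp _ (fun y => phi (y, t)) (shift omega) _ _ _ d
    (is_derive_shift x 1 omega).
  rewrite mulr1 (_ : _ \o _ = fun y => phi (y, t)); last first.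
    by apply/funext => y /=; rewrite pphi.
  by move=> /(is_derive_pdxP phi x t _).1[].
- exists s0, s1; split=> // x t st.
  apply: ((is_derive_pdxP phi x t 0).1 _).2.
  under eq_fun do rewrite phi0//.
  exact: is_derive_cst.
Qed.

End test_functions.

(** * Integration over rectangles *)

Section plane_integrals.
Context {R : realType}.
Notation mu := (@lebesgue_measure R).
Notation RR := (measurableTypeR R * measurableTypeR R)%type.
Notation P := (@plane_measure R).

(** An open set of the plane is a countable union of boxes with rational
    corners; this connects the product topology, in which test functions are
    continuous, with the product sigma-algebra, on which the plane measure
    lives. *)
Lemma open_measurable_plane (U : set (R * R)) :
  open U -> measurable (U : set RR).
Proof.
move=> oU.
pose box (q : rat * rat * (rat * rat)) : set (R * R) :=
  `]ratr q.1.1, ratr q.1.2[ `*` `]ratr q.2.1, ratr q.2.2[.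
have -> : U = \bigcup_q (if `[< box q `<=` U >] then box q else set0).
  apply/seteqP; split=> [[x t] Uxt|z [q _]]; last first.
    by case: ifPn => // /asboolP; apply.
  have /nbhs_ballP[e /= e0 eU] : nbhs (x, t) U by exact: open_nbhs_nbhs.
  have rat_below (y : R) : exists q : rat, y - e < ratr q < y.
    have /rat_in_itvoo[q] : y - e < y by rewrite ltrBlDr ltrDl.
    by rewrite in_itv/=; exists q.
  have rat_above (y : R) : exists q : rat, y < ratr q < y + e.
    have /rat_in_itvoo[q] : y < y + e by rewrite ltrDl.
    by rewrite in_itv/=; exists q.
  have [a /andP[xa ax]] := rat_below x; have [b /andP[xb bx]] := rat_above x.
  have [c /andP[tc ct]] := rat_below t; have [d /andP[td dt]] := rat_above t.
  have boxU : box ((a, b), (c, d)) `<=` U.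
    move=> [y s] [/=]; rewrite !in_itv/= => /andP[ay yb] /andP[cs sd].
    apply: eU; split; rewrite /ball/= ltr_norml; apply/andP; split; lra.
  exists ((a, b), (c, d)) => //; rewrite ifT; last exact/asboolP.
  by split; rewrite /= in_itv/=; apply/andP.
apply: countable_bigcupT_measurable; first exact: countableP.
move=> q; case: ifPn => // _.
by apply: measurableX; exact: measurable_itv.
Qed.

Lemma continuous_measurable_plane (f : R * R -> R) :
  continuous f -> measurable_fun [set: RR] (f : RR -> R).
Proof.
move=> /continuousP cf; apply: (measurability _ (RGenOpens.measurableE R)).
move=> _ [_ [a [b ->] <-]]; rewrite setTI; apply: open_measurable_plane.
exact/cf/interval_open.
Qed.

Section rectangle.
Variables a b c d : R.
Let rect : set RR := `[a, b] `*` `[c, d].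

Lemma measurable_rect : measurable rect.
Proof. by apply: measurableX; exact: measurable_itv. Qed.

Lemma integrable_rectM (u f : R * R -> R) : continuous f ->
  P.-integrable rect (EFin \o u) ->
  P.-integrable rect (EFin \o (fun z => u z * f z)).
Proof.
move=> cf iu; rewrite (_ : EFin \o _ = ((EFin \o u) \* (EFin \o f))%E)//.
apply: integrableMl => //.
- exact: measurable_rect.
- apply: measurable_funTS; exact: continuous_measurable_plane.
- have : compact (f @` rect).
    apply: continuous_compact; first exact: continuous_subspaceT.
    by apply: compact_setX; exact: segment_compact.
  move=> /compact_bounded[M [Mr HM]]; exists M; split => // y My z rz.
  by apply: HM => //; exists z.
Qed.

Lemma integrable_rect_continuous (f : R * R -> R) : continuous f ->
  P.-integrable rect (EFin \o f).
Proof.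
move=> cf; rewrite (_ : f = fun z => cst 1 z * f z); last first.
  by apply/funext => z; rewrite mul1r.
apply: integrable_rectM => //; apply: measurable_bounded_integrable.
- exact: measurable_rect.
- rewrite /= product_measure1E/=; [|exact: measurable_itv..].
  by rewrite !lebesgue_measure_itv/=; do !case: ifPn => _;
    rewrite ?mul0e ?mule0 ?ltry// -?EFinB -?EFinM ?ltry.
- exact: measurable_cst.
- exact: bounded_cst.
Qed.

Variable u : R * R -> R.
Hypothesis iu : P.-integrable rect (EFin \o u).
Let v : RR -> \bar R := (EFin \o u) \_ rect.

Let iv : P.-integrable setT v.
Proof. exact: ((integrable_mkcond _ measurable_rect).1 iu). Qed.

Let vE x t : v (x, t) = if (x \in `[a, b]) && (t \in `[c, d]) then (u (x, t))%:E
                        else 0%E.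
Proof.
rewrite /v patchE/=; congr (if _ then _ else _).
apply/idP/idP => [|/andP[xab tcd]]; rewrite inE; first by case=> /= -> ->.
by split.
Qed.

Lemma integral_rect_xt :
  (\int[P]_(z in rect) (u z)%:E =
   \int[mu]_(x in `[a, b]) \int[mu]_(t in `[c, d]) (u (x, t))%:E)%E.
Proof.
rewrite integral_mkcond -(integral12_prod_meas1 iv) [RHS]integral_mkcond.
apply: eq_integral => x _; rewrite /fubini_F patchE mem_setE.
case: ifPn => xab.
  rewrite [RHS]integral_mkcond; apply: eq_integral => t _.
  by rewrite vE xab/= patchE mem_setE.
by apply: integral0_eq => t _; rewrite vE (negbTE xab).
Qed.

Let fubini_GE t : fubini_G mu v t =
  ((fun t => \int[mu]_(x in `[a, b]) (u (x, t))%:E) \_ `[c, d])%E t.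
Proof.
rewrite /fubini_G patchE mem_setE; case: ifPn => tcd.
  rewrite [RHS]integral_mkcond; apply: eq_integral => x _.
  by rewrite vE tcd andbT patchE mem_setE.
by apply: integral0_eq => x _; rewrite vE (negbTE tcd) andbF.
Qed.

Lemma integral_rect_tx :
  (\int[P]_(z in rect) (u z)%:E =
   \int[mu]_(t in `[c, d]) \int[mu]_(x in `[a, b]) (u (x, t))%:E)%E.
Proof.
rewrite integral_mkcond -(integral21_prod_meas1 iv) [RHS]integral_mkcond.
by apply: eq_integral => t _; exact: fubini_GE.
Qed.

Lemma measurable_rect_integral_x :
  measurable_fun `[c, d] (fun t => \int[mu]_(x in `[a, b]) (u (x, t))%:E)%E.
Proof.
apply/(measurable_restrictT _ (measurable_itv _)) => /=.
by have := measurable_fubini_G iv; rewrite (funext fubini_GE).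
Qed.

Lemma ae_integrable_rect_x : {ae mu, forall t, `[c, d]%classic t ->
  mu.-integrable `[a, b] (fun x => (u (x, t))%:E)}.
Proof.
have := ae_integrable2 iv; apply: filterS => t it tcd.
apply/integrable_mkcond => //; apply: eq_integrable it => // x _.
by rewrite vE patchE mem_setE [t \in _]tcd andbT.
Qed.

End rectangle.

(** The inner integral of h is only known, and only makes sense as a Lebesgue
    integral, for almost every t. *)
Lemma integral_rect_separated (h : R * R -> R) (g : R -> R) (a b c d m : R) :
  P.-integrable (`[a, b] `*` `[c, d]) (EFin \o h) -> continuous g ->
  {ae mu, forall t, `[c, d]%classic t ->
    \int[mu]_(x in `[a, b]) h (x, t) = m} ->
  \int[P]_(z in `[a, b] `*` `[c, d]) (h z * g z.2) =
  m * \int[mu]_(t in `[c, d]) g t.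
Proof.
move=> ih cg hm.
have ig : mu.-integrable `[c, d] (EFin \o g).
  exact: continuous_integrable_itvcc.
have ihg : P.-integrable (`[a, b] `*` `[c, d]) (EFin \o (fun z => h z * g z.2)).
  apply: (@integrable_rectM _ _ _ _ h (fun z => g z.2)) => // z.
  by apply: (@cvg_comp _ _ _ snd g); [exact: cvg_snd|exact: cg].
rewrite -RintegralZl// /Rintegral (integral_rect_tx ihg); congr fine.
apply: ae_eq_integral => //.
- exact: measurable_rect_integral_x ihg.
- apply/measurable_EFinP/measurable_funM => //.
  by apply: measurable_funTS; exact: continuous_measurable_fun.
- have := ae_integrable_rect_x ih; move: hm; rewrite /ae_eq.
  have aeF : Filter (nbhs (almost_everywhere mu)).
    exact: ae_filter_ringOfSetsType.
  apply: filterS2 => t hmt iht tcd.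
  rewrite /=; under eq_integral do rewrite EFinM.
  have {}iht := iht tcd; rewrite integralZr// -(hmt tcd) EFinM; congr (_ * _)%E.
  by rewrite /Rintegral fineK//; exact: integrable_fin_num.
Qed.

(** The fundamental theorem of calculus on an interval that contains [s0, s1]
    in its interior, so that F vanishes at the end points. *)
Lemma Rintegral_derive_support (D : set R) (F f : R -> R) (s0 s1 : R) :
  (forall s : R, is_derive s 1 F (f s)) -> continuous f ->
  (forall s, ~ (s0 <= s <= s1) -> F s = 0) ->
  (forall s, ~ (s0 <= s <= s1) -> f s = 0) ->
  `[s0, s1] `<=` D -> \int[mu]_(s in D) f s = 0.
Proof.
move=> dF cf F0 f0 sD.
(* b works also when [s0, s1] is empty *)
pose a := s0 - 1; pose b := Num.max s0 s1 + 1.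
have s1b : s1 < b by rewrite /b ltr_pwDr// le_max lexx orbT.
have ab : a < b by rewrite /a /b ltrBlDr -addrA ltr_pwDr// le_max lexx.
have Fa : F a = 0 by apply: F0 => /andP[]; rewrite /a lerBrDr gerDl ler10.
have Fb : F b = 0 by apply: F0 => /andP[_]; rewrite leNgt s1b.
transitivity (\int[mu]_(s in `[a, b]) f s); last first.
  by rewrite (Rintegral_FTC2 ab cf dF) Fa Fb subrr.
rewrite Rintegral_mkcond [RHS]Rintegral_mkcond; congr (Rintegral _ _ _).
apply/funext => s; rewrite !patchE.
have [sin|sout] := boolP (s0 <= s <= s1); last first.
  by rewrite f0 ?if_same//; exact/negP.
have /andP[s0s ss1] := sin.
rewrite !mem_set//; last exact: sD.
by rewrite /= in_itv/= (ltW (le_lt_trans ss1 s1b)) andbT /a lerBlDr ler_wpDr.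
Qed.

End plane_integrals.

(** * Distributions on the cylinder *)

Section distributions.
Context {R : realType} (omega : R) (t0 t1 : \bar R).
Hypothesis omega_gt0 : 0 < omega.
Implicit Types (u phi : R * R -> R).
Notation mu := (@lebesgue_measure R).
Notation RR := (measurableTypeR R * measurableTypeR R)%type.
Notation P := (@plane_measure R).
Notation reg := (regular omega t0 t1).
Notation test := (test_function omega t0 t1).
Notation rect s0 s1 := (`[0, omega] `*` `[s0, s1] : set RR).

Lemma segment_time_interval (s0 s1 : R) :
  time_interval t0 t1 s0 -> time_interval t0 t1 s1 ->
  `[s0, s1] `<=` time_interval t0 t1.
Proof.
move=> /andP[t0s0 _] /andP[_ s1t1] s /=; rewrite in_itv/= => /andP[s0s ss1].
rewrite /time_interval/= (lt_le_trans t0s0) ?lee_fin//=.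
by rewrite (le_lt_trans _ s1t1)// lee_fin.
Qed.

(** The time support of phi confines the integral to a compact rectangle, the
    only kind of set on which u is assumed to be integrable. *)
Lemma regularE u phi (s0 s1 : R) :
  time_interval t0 t1 s0 -> time_interval t0 t1 s1 ->
  (forall x t, ~ (s0 <= t <= s1) -> phi (x, t) = 0) ->
  reg u phi = \int[P]_(z in rect s0 s1) (u z * phi z).
Proof.
move=> Is0 Is1 phi0.
rewrite /regular Rintegral_mkcond [RHS]Rintegral_mkcond.
congr (Rintegral _ _ _); apply/funext => -[x t]; rewrite !patchE.
have [tin|tout] := boolP (s0 <= t <= s1); last first.
  by rewrite (phi0 x t) ?mulr0 ?if_same//; exact/negP.
suff -> : ((x, t) \in cylinder omega t0 t1) = ((x, t) \in rect s0 s1) by [].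
have tI : time_interval t0 t1 t.
  by apply: (segment_time_interval Is0 Is1); rewrite /= in_itv.
by apply/idP/idP; rewrite !inE => -[/= xI _]; split.
Qed.

Lemma regularB u v phi : test phi ->
  loc_integrable omega t0 t1 u -> loc_integrable omega t0 t1 v ->
  reg (fun z => u z - v z) phi = reg u phi - reg v phi.
Proof.
move=> [sphi _ [s0 [s1 [Is0 Is1 phi0]]]] iu iv.
rewrite !(regularE _ Is0 Is1 phi0) -RintegralB.
- by apply: eq_Rintegral => z _; rewrite mulrBl.
- exact: measurable_rect.
- by apply: integrable_rectM; [exact: (sphi 0)|exact: iu].
- by apply: integrable_rectM; [exact: (sphi 0)|exact: iv].
Qed.

Lemma delta_pdt (a : R) phi : test phi -> delta t0 t1 a (pdt phi) = 0.
Proof.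
move=> [sphi _ [s0 [s1 [Is0 Is1 phi0]]]].
apply: (Rintegral_derive_support (F := fun t => phi (a, t))
  (s0 := s0) (s1 := s1)).
- by move=> s; exact: class_C_is_derive_pdt (sphi 1).
- by apply: continuous_section2; exact: (smooth_pdt sphi 0).
- by move=> s; exact: phi0.
- by move=> s; exact: pdt_eq0.
- exact: segment_time_interval.
Qed.

Lemma regular_cst_pdt (A : R) phi : test phi -> reg (cst A) (pdt phi) = 0.
Proof.
move=> [sphi _ [s0 [s1 [Is0 Is1 phi0]]]].
have phit0 := pdt_eq0 phi0.
have cphit : continuous (fun z => cst A z * pdt phi z).
  by move=> z; apply: cvgMr; exact: (smooth_pdt sphi 0).
rewrite (regularE _ Is0 Is1 phit0) /Rintegral integral_rect_xt; last first.
  exact: integrable_rect_continuous.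
rewrite integral0_eq// => x _.
have cx : continuous (fun t => A * pdt phi (x, t)).
  exact: (continuous_section2 (z := x) cphit).
rewrite -[LHS]fineK; last first.
  by apply: integrable_fin_num => //; exact: continuous_integrable_itvcc.
congr EFin; rewrite -[LHS]/(\int[mu]_(t in `[s0, s1]) (A * pdt phi (x, t))).
rewrite RintegralZl//; last first.
  apply: continuous_integrable_itvcc.
  by apply: continuous_section2; exact: (smooth_pdt sphi 0).
rewrite [X in _ * X](_ : _ = 0) ?mulr0//.
apply: (Rintegral_derive_support (F := fun t => phi (x, t))
  (s0 := s0) (s1 := s1)) => //.
- by move=> s; exact: class_C_is_derive_pdt (sphi 1).
- by apply: continuous_section2; exact: (smooth_pdt sphi 0).
- by move=> s; exact: phi0.
- by move=> s; exact: phit0.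
Qed.

(** Each term of the source is constant in time, and a time derivative of a
    test function integrates to zero along every vertical line. *)
Lemma source_pdt (K : nat) (c a : 'I_K -> R) (A : R) phi : test phi ->
  source omega t0 t1 c a A (pdt phi) = 0.
Proof.
move=> tphi; rewrite /source.
pose ev0 (u : distr R) := u (pdt phi) = 0.
have : ev0 (\sum_k c k *: delta t0 t1 (a k)).
  apply: (big_ind ev0) => //.
    by move=> u v u0 v0; rewrite /ev0/= -[LHS]/(u _ + v _) u0 v0 addr0.
  move=> k _; rewrite /ev0 -[LHS]/(c k * delta t0 t1 (a k) (pdt phi)).
  by rewrite delta_pdt// mulr0.
rewrite /ev0 => s0.
rewrite -[LHS]/((\sum_k c k *: delta t0 t1 (a k) : distr R) (pdt phi)
  - reg (cst A) (pdt phi)).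
by rewrite s0 regular_cst_pdt// subr0.
Qed.

(** Integrating in x first turns the pairing into the constant spatial integral
    of u times the integral of the time derivative of [mean omega phi]. *)
Lemma regular_mean_pdt u phi : test phi -> loc_integrable omega t0 t1 u ->
  mean_conserved omega t0 t1 u -> reg u (mean omega (pdt phi)) = 0.
Proof.
move=> [sphi _ [s0 [s1 [Is0 Is1 phi0]]]] iu [m um].
have phit0 := pdt_eq0 phi0.
rewrite (@regularE _ _ s0 s1)//; last first.
  by move=> x t st; apply: mean_eq0 => y; exact: phit0.
have cm : continuous (fun t => mean omega (pdt phi) (0, t)).
  apply: continuous_section2; exact: (smooth_mean omega (smooth_pdt sphi) 0).
rewrite (integral_rect_separated (m := m) _ cm); last 2 first.
- exact: iu.
- have aeF : Filter (nbhs (almost_everywhere mu)).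
    exact: ae_filter_ringOfSetsType.
  apply: filterS um => t um tin; apply: um.
  exact: (segment_time_interval Is0 Is1).
rewrite [X in _ * X](_ : _ = 0) ?mulr0//.
apply: (Rintegral_derive_support (F := fun t => mean omega phi (0, t))
  (s0 := s0) (s1 := s1)) => //.
- by move=> s; exact: is_derive_mean_t.
- by move=> s st; apply: mean_eq0 => y; exact: phi0.
- by move=> s st; apply: mean_eq0 => y; exact: phit0.
Qed.

(** The weak form of: u_xx stationary and the mean of u conserved imply
    u_t = 0. The equation is tested with the second primitive of the
    fluctuation of phi_t, and the mean of phi_t is paired separately. *)
Lemma dt_eq0_of_dxx_eq_source (K : nat) (c a : 'I_K -> R) (A sigma : R) u :
  sigma != 0 -> loc_integrable omega t0 t1 u -> mean_conserved omega t0 t1 u ->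
  eq_distr omega t0 t1 (sigma *: dxx (reg u)) (source omega t0 t1 c a A) ->
  forall phi, test phi -> reg u (pdt phi) = 0.
Proof.
move=> sigma0 iu um uE phi tphi.
have tg : test (inv_dxx omega (pdt phi)).
  exact/test_function_inv_dxx/test_function_pdt.
have [sphi pphi [s0 [s1 [Is0 Is1 phi0]]]] := tphi.
have phit0 := pdt_eq0 phi0.
have sphit := smooth_pdt sphi.
have /eqP : sigma * reg u (pdx (pdx (inv_dxx omega (pdt phi)))) = 0.
  rewrite -[LHS]/((sigma *: dxx (reg u)) (inv_dxx omega (pdt phi))) uE//.
  (* the test function is itself a time derivative *)
  rewrite -pdt_inv_dxx//; apply: source_pdt.
  exact: test_function_inv_dxx.
rewrite mulf_eq0 (negbTE sigma0)/= pdxx_inv_dxx// => /eqP ufl.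
have m0 := regular_mean_pdt tphi iu um.
have mt0 x t : ~ (s0 <= t <= s1) -> mean omega (pdt phi) (x, t) = 0.
  by move=> st; apply: mean_eq0 => y; exact: phit0.
have ft0 x t : ~ (s0 <= t <= s1) -> fluct omega (pdt phi) (x, t) = 0.
  by move=> st; rewrite /fluct phit0// mt0// subr0.
move: ufl m0; rewrite (regularE _ Is0 Is1 ft0) (regularE _ Is0 Is1 mt0).
rewrite (regularE _ Is0 Is1 phit0) => ufl m0.
transitivity (\int[P]_(z in rect s0 s1) (u z * fluct omega (pdt phi) z)
  + \int[P]_(z in rect s0 s1) (u z * mean omega (pdt phi) z)); last first.
  by rewrite ufl m0 addr0.
rewrite -RintegralD.
- by apply: eq_Rintegral => z _; rewrite -mulrDr subrK.
- exact: measurable_rect.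
- apply: integrable_rectM; last exact: iu.
  exact: (smooth_fluct omega sphit 0).
- apply: integrable_rectM; last exact: iu.
  exact: (smooth_mean omega sphit 0).
Qed.

End distributions.

Theorem proposition2p1 (R : realType) (omega sigma1 sigma2 alpha tau : R)
    (t0 t1 : \bar R) (K : nat) (a c : 'I_K -> R) (A : R)
    (h zeta eta : R * R -> R)
    (homega : 0 < omega) (hsigma1 : 0 < sigma1) (hsigma2 : 0 < sigma2)
    (halpha : 0 <= alpha) (hK : (1 <= K)%N)
    (ha_range : forall k, 0 <= a k < omega)
    (ha_incr : forall i j : 'I_K, (i < j)%N -> a i < a j)
    (hh : cylinder_function omega t0 t1 h)
    (hzeta : cylinder_function omega t0 t1 zeta)
    (heta : forall z, eta z = zeta z - h z) :
  let f := source omega t0 t1 c a A in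
  let reg := regular omega t0 t1 in
  eq_distr omega t0 t1
    (tau *: dt (reg h)) (sigma1 *: dxx (reg h) - f) ->
  eq_distr omega t0 t1
    (dt (reg zeta))
    (sigma2 *: dxx (reg zeta) - alpha *: reg (fun z => zeta z - h z)) ->
  (0 < tau -> sigma2 = sigma1 / tau ->
     eq_distr omega t0 t1
       (dt (reg eta))
       (sigma2 *: dxx (reg eta) - alpha *: reg eta + tau^-1 *: f)) /\
  (tau = 0 -> mean_conserved omega t0 t1 h ->
     eq_distr omega t0 t1
       (dt (reg eta))
       (sigma2 *: dxx (reg eta) - alpha *: reg eta
        + (sigma2 / sigma1) *: f)).
Proof.
move=> f reg hE zE.
have [[_ ih] [_ iz]] := (hh, hzeta).
have etaE : eta = fun z => zeta z - h z by exact/funext.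
have regE phi : test_function omega t0 t1 phi ->
    reg eta phi = reg zeta phi - reg h phi.
  by move=> tphi; rewrite etaE; exact: regularB.
have lhsE phi : test_function omega t0 t1 phi ->
    - reg zeta (pdt phi) =
      sigma2 * reg zeta (pdx (pdx phi)) - alpha * reg eta phi.
  by move=> tphi; rewrite etaE; exact: (zE _ tphi).
have hE' phi : test_function omega t0 t1 phi ->
    tau * (- reg h (pdt phi)) = sigma1 * reg h (pdx (pdx phi)) - f phi.
  exact: hE.
split=> [tau0 s21|tau0 hm] phi tphi.
- have tpt := test_function_pdt tphi.
  have tpxx := test_function_pdx (test_function_pdx tphi).
  have combine (Zxx Zt Hxx Ht E F : R) : tau * (- Ht) = sigma1 * Hxx - F ->
      - Zt = sigma2 * Zxx - alpha * E ->
      - (Zt - Ht) = sigma2 * (Zxx - Hxx) - alpha * E + tau^-1 * F.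
    move=> hHt hZt.
    have -> : F = sigma1 * Hxx + tau * Ht by lra.
    by rewrite opprB addrC hZt s21; field; rewrite gt_eqF.
  rewrite -[LHS]/(- reg eta (pdt phi)).
  rewrite -[RHS]/(sigma2 * reg eta (pdx (pdx phi)) - alpha * reg eta phi
    + tau^-1 * f phi).
  rewrite (regE _ tpt) (regE _ tpxx).
  exact: (combine _ _ _ _ _ _ (hE' _ tphi) (lhsE _ tphi)).
- have tpt := test_function_pdt tphi.
  have tpxx := test_function_pdx (test_function_pdx tphi).
  have ht : reg h (pdt phi) = 0.
    have sigma1_neq0 : sigma1 != 0 by rewrite gt_eqF.
    apply: (@dt_eq0_of_dxx_eq_source _ _ _ _ homega K c a A _ h
      sigma1_neq0 ih hm _ _ tphi).
    move=> psi tpsi; have := hE' _ tpsi; rewrite tau0 mul0r.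
    by move=> /esym/eqP; rewrite subr_eq0 => /eqP h_xx; exact: h_xx.
  have combine (Zxx Zt Hxx Ht E F : R) : Ht = 0 ->
      tau * (- Ht) = sigma1 * Hxx - F -> - Zt = sigma2 * Zxx - alpha * E ->
      - (Zt - Ht) = sigma2 * (Zxx - Hxx) - alpha * E + sigma2 / sigma1 * F.
    move=> -> hHxx hZt.
    have -> : F = sigma1 * Hxx by lra.
    by rewrite subr0 hZt; field; rewrite gt_eqF.
  rewrite -[LHS]/(- reg eta (pdt phi)).
  rewrite -[RHS]/(sigma2 * reg eta (pdx (pdx phi)) - alpha * reg eta phi
    + sigma2 / sigma1 * f phi).
  rewrite (regE _ tpt) (regE _ tpxx).
  exact: (combine _ _ _ _ _ _ ht (hE' _ tphi) (lhsE _ tphi)).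
Qed.
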